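(* Let $R$ be an integral domain, $n=2$, $R[\mathbf{x}]=R[x_1,x_2]$, and let $G$ be a subgroup of $\mathrm{Aff}(R,\mathbf{x})$. Let $\Gamma$ be a totally ordered additive group and $\mathbf{w}=(w_1,w_2)\in\Gamma^2$ with $w_1>0$ or $w_2>0$. If $\phi\in G^+$ satisfies $\deg_{\mathbf{w}}\phi>|\mathbf{w}|$, then $\phi$ admits a $\bar{G}$-reduction or an elementary reduction for the weight $\mathbf{w}$.
   Context: $\mathrm{Aut}(R[\mathbf{x}]/A)$ denotes the automorphisms of the ring $R[\mathbf{x}]$ over a subalgebra $A$; composition is $(\sigma\circ\tau)(f)=\sigma(\tau(f))$. An $R$-automorphism $\phi$ is affine if $\deg\phi(x_i)=1$ for all $i$ (total degree); it is elementary if $\phi\in\mathrm{Aut}(R[\mathbf{x}]/A_i)$ for some $i$, where $A_i=R[\{x_j: j\neq i\}]$. $\mathrm{Aff}(R,\mathbf{x})$, $\mathrm{E}(R,\mathbf{x})$, $\mathrm{T}(R,\mathbf{x})$ denote the subgroups generated by affine automorphisms, elementary automorphisms, and both, respectively. $G^+$ is the subgroup of $\mathrm{T}(R,\mathbf{x})$ generated by $G\cup\mathrm{E}(R,\mathbf{x})$. $\mathrm{E}_0(R,\mathbf{x})$ is the subgroup generated by $\bigcup_i \mathrm{Aut}(R[\mathbf{x}]/A_i)\cap\mathrm{Aff}(R,\mathbf{x})$, and $\bar G$ is the subgroup of $\mathrm{Aff}(R,\mathbf{x})$ generated by $G\cup\mathrm{E}_0(R,\mathbf{x})$. A totally ordered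 additive group is a finitely generated abelian group with a total order compatible with addition. For $\mathbf{w}\in\Gamma^2$, the $\mathbf{w}$-degree of a monomial $x_1^{a_1}x_2^{a_2}$ is $a_1w_1+a_2w_2$, $\deg_{\mathbf{w}}f$ is the maximum over monomials of $f\ne0$, $\deg_{\mathbf{w}}\phi=\deg_{\mathbf{w}}\phi(x_1)+\deg_{\mathbf{w}}\phi(x_2)$ and $|\mathbf{w}|=w_1+w_2$. $\phi$ admits a $\bar G$-reduction for $\mathbf{w}$ if $\deg_{\mathbf{w}}(\phi\circ\alpha)<\deg_{\mathbf{w}}\phi$ for some $\alpha\in\bar G$, and an elementary reduction for $\mathbf{w}$ if $\deg_{\mathbf{w}}(\phi\circ\epsilon)<\deg_{\mathbf{w}}\phi$ for some $\epsilon\in\mathrm{Aut}(R[\mathbf{x}]/A_i)$, $i\in\{1,2\}$. *)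

(* Defs.v *)
From HB Require Import structures.
From mathcomp Require Import all_boot all_order all_algebra.
From mathcomp Require Import mpoly.
Set Implicit Arguments. Unset Strict Implicit. Unset Printing Implicit Defensive.
Import Order.TTheory GRing.Theory.
Local Open Scope ring_scope.

Definition total_order_compat (Γ : zmodType) (le : rel Γ) : Prop :=
  [/\ reflexive le, antisymmetric le, transitive le, total le
    & forall a b c : Γ, le a b -> le (a + c) (b + c)].

Definition fin_gen_zmod (Γ : zmodType) : Prop :=
  exists s : seq Γ, forall g : Γ,
    exists c : seq int, g = \sum_(i < size s) s`_i *~ c`_i.

Definition is_tot_ord_group (Γ : zmodType) (le : rel Γ) : Prop :=
  total_order_compat le /\ fin_gen_zmod Γ.

Definition ltG (Γ : zmodType) (le : rel Γ) (a b : Γ) : bool := le a b && (a != b).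

Definition maxG (Γ : zmodType) (le : rel Γ) (a b : Γ) : Γ := if le a b then b else a.

(* An R-algebra endomorphism phi of R[x1,x2] is determined by (phi x1, phi x2);
   it acts on f by f \mPo phi. *)
Definition endo (R : nzRingType) := 2.-tuple {mpoly R[2]}.

Definition idE (R : nzRingType) : endo R := [tuple 'X_i | i < 2].

(* (sigma o tau)(f) = sigma(tau(f)); on generators: (sigma o tau)(x_i) = tau(x_i) \mPo sigma *)
Definition endo_comp (R : nzRingType) (sigma tau : endo R) : endo R :=
  [tuple comp_mpoly sigma (tnth tau i) | i < 2].

Definition is_inverse (R : nzRingType) (phi psi : endo R) : Prop :=
  endo_comp phi psi = idE R /\ endo_comp psi phi = idE R.

Definition is_aut (R : nzRingType) (phi : endo R) : Prop := exists psi, is_inverse phi psi.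

Inductive gen_grp (R : nzRingType) (S : endo R -> Prop) : endo R -> Prop :=
| gen_base phi : S phi -> gen_grp S phi
| gen_id : gen_grp S (idE R)
| gen_comp phi psi : gen_grp S phi -> gen_grp S psi -> gen_grp S (endo_comp phi psi)
| gen_inv phi psi : gen_grp S phi -> is_inverse phi psi -> gen_grp S psi.

(* affine: deg phi(x_i) = 1 (total degree) for all i; msize = total degree + 1 *)
Definition is_affine (R : nzRingType) (phi : endo R) : Prop :=
  is_aut phi /\ forall i : 'I_2, msize (tnth phi i) = 2%N.

(* phi in Aut(R[x]/A_i), A_i = R[x_j : j <> i] *)
Definition in_Aut_over_A (R : nzRingType) (i : 'I_2) (phi : endo R) : Prop :=
  is_aut phi /\ forall j : 'I_2, j != i -> tnth phi j = 'X_j.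

Definition is_elementary (R : nzRingType) (phi : endo R) : Prop :=
  exists i, in_Aut_over_A i phi.

Definition Aff (R : nzRingType) := gen_grp (@is_affine R).
Definition Elem (R : nzRingType) := gen_grp (@is_elementary R).
Definition Tame (R : nzRingType) := gen_grp (fun phi : endo R => is_affine phi \/ is_elementary phi).
Definition E0 (R : nzRingType) := gen_grp (fun phi : endo R => is_affine phi /\ is_elementary phi).

Definition is_subgroup (R : nzRingType) (G : endo R -> Prop) : Prop :=
  [/\ G (idE R),
      (forall phi psi, G phi -> G psi -> G (endo_comp phi psi))
    & (forall phi psi, G phi -> is_inverse phi psi -> G psi)].

Definition Gplus (R : nzRingType) (G : endo R -> Prop) :=
  gen_grp (fun phi : endo R => G phi \/ Elem phi).
Definition Gbar (R : nzRingType) (G : endo R -> Prop) :=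
  gen_grp (fun phi : endo R => G phi \/ E0 phi).

Definition wdeg_mon (Γ : zmodType) (w1 w2 : Γ) (m : 'X_{1..2}) : Γ :=
  w1 *+ m ord0 + w2 *+ m (Ordinal (isT : (1 < 2)%N)).

(* deg_w f = max of w-degrees over the monomials of f (f <> 0; value 0 for f = 0,
   never used for automorphisms) *)
Definition wdeg (R : nzRingType) (Γ : zmodType) (le : rel Γ) (w1 w2 : Γ)
    (f : {mpoly R[2]}) : Γ :=
  match [seq wdeg_mon w1 w2 m | m <- msupp f] with
  | [::] => 0
  | d :: ds => foldl (maxG le) d ds
  end.

Definition wdeg_endo (R : nzRingType) (Γ : zmodType) (le : rel Γ) (w1 w2 : Γ)
    (phi : endo R) : Γ :=
  wdeg le w1 w2 (tnth phi ord0) + wdeg le w1 w2 (tnth phi (Ordinal (isT : (1 < 2)%N))).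

Definition admits_Gbar_reduction (R : nzRingType) (G : endo R -> Prop)
    (Γ : zmodType) (le : rel Γ) (w1 w2 : Γ) (phi : endo R) : Prop :=
  exists alpha, Gbar G alpha /\
    ltG le (wdeg_endo le w1 w2 (endo_comp phi alpha)) (wdeg_endo le w1 w2 phi).

Definition admits_elem_reduction (R : nzRingType)
    (Γ : zmodType) (le : rel Γ) (w1 w2 : Γ) (phi : endo R) : Prop :=
  exists (i : 'I_2) eps, in_Aut_over_A i eps /\
    ltG le (wdeg_endo le w1 w2 (endo_comp phi eps)) (wdeg_endo le w1 w2 phi).

(* Main.v *)
(* Composing phi = (f1, f2) on the right with alpha substitutes (f1, f2) into the
   components of alpha.  As in the amalgamated product structure of the tame group,
   every phi in G^+ is g0 t1 g1 ... tk gk with g_i in Gbar and each t_i triangular,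
   (x1, x2) -> (a x1 + p(x2), d x2 + e) with deg p >= 2, where for 0 < i < k the
   second component of g_i involves x1.  Along such a word, the first component
   strictly dominates in w-degree after every t_i, provided one of the weights is
   positive; the only state where degrees need not grow is the start with g0 itself
   triangular.  So if both components of the last g_k involve x1, removing g_k lowers
   the degree; otherwise g_k is absorbed, up to exchanging x1 and x2, into t_k, and
   an elementary automorphism undoes the polynomial p (or a constant). *)
Require Import Defs.
From HB Require Import structures.
From mathcomp Require Import all_boot all_order all_algebra.
From mathcomp Require Import mpoly.
From mathcomp Require Import ring.
Import GRing.Theory.
Set Implicit Arguments. Unset Strict Implicit. Unset Printing Implicit Defensive.
Local Open Scope ring_scope.

(** * Ordered groups and weighted degrees *)

Section OrderedGroup.
Context (Γ : zmodType) (le : rel Γ) (Hle : total_order_compat le).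

Let lexx : reflexive le. Proof. by case: Hle. Qed.
Let le_anti : antisymmetric le. Proof. by case: Hle. Qed.
Let letr : transitive le. Proof. by case: Hle. Qed.
Let letot : total le. Proof. by case: Hle. Qed.

Lemma leG_refl a : le a a. Proof. exact: lexx. Qed.

Lemma leG_trans b a c : le a b -> le b c -> le a c.
Proof. exact: letr. Qed.

Lemma leGVltG a b : le a b \/ ltG le b a.
Proof.
rewrite /ltG; case: (boolP (le a b)) => [|nab]; [by left | right].
have := letot a b; rewrite (negbTE nab) /= => ->; apply: contraNneq nab => ->.
exact: lexx.
Qed.

Lemma ltGW a b : ltG le a b -> le a b. Proof. by case/andP. Qed.

Lemma ltG_le_trans b a c : ltG le a b -> le b c -> ltG le a c.
Proof.
case/andP=> ab nab bc; rewrite /ltG (letr ab bc) /=.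
apply: contraNneq nab => ac; apply/eqP/le_anti; rewrite ab /=.
by rewrite ac.
Qed.

Lemma leG_lt_trans b a c : le a b -> ltG le b c -> ltG le a c.
Proof.
move=> ab /andP[bc nbc]; rewrite /ltG (letr ab bc) /=.
apply: contraNneq nbc => ac; apply/eqP/le_anti; rewrite bc /=.
by rewrite -ac.
Qed.

Lemma leG_add a b c d : le a b -> le c d -> le (a + c) (b + d).
Proof.
case: Hle => _ _ _ _ H ab cd; apply: (@leG_trans (b + c)); first exact: H.
by rewrite ![b + _]addrC; apply: H.
Qed.

Lemma ltG_le_add a b c d : ltG le a b -> le c d -> ltG le (a + c) (b + d).
Proof.
move=> ab cd; apply: (@ltG_le_trans (b + c)); last exact: leG_add.
case/andP: ab => ab nab; rewrite /ltG leG_add //=.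
by rewrite (inj_eq (addIr c)).
Qed.

Lemma leG_lt_add a b c d : le a b -> ltG le c d -> ltG le (a + c) (b + d).
Proof. by move=> ab cd; rewrite addrC [b + _]addrC; apply: ltG_le_add. Qed.

Lemma ltGxx a : ltG le a a = false.
Proof. by rewrite /ltG eqxx andbF. Qed.

Lemma mulrn_gtG0 a n : ltG le 0 a -> (0 < n)%N -> ltG le 0 (a *+ n).
Proof.
move=> a0; elim: n => [//|[|n] IHn] _; first by rewrite mulr1n.
by rewrite mulrS -[0]addr0; apply: ltG_le_add; rewrite ?ltGW ?IHn.
Qed.

Lemma ltG_mulrn a n : ltG le 0 a -> (1 < n)%N -> ltG le a (a *+ n).
Proof.
case: n => [//|n] a0 n1; rewrite mulrS -[a in ltG le a _]addr0.
by apply: leG_lt_add; [exact: lexx | exact: mulrn_gtG0].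
Qed.

End OrderedGroup.

Section WeightedDegree.
Context (R : idomainType) (Γ : zmodType) (le : rel Γ).
Context (Hle : total_order_compat le) (w1 w2 : Γ).
Implicit Types (f g : {mpoly R[2]}) (d e : Γ) (m : 'X_{1..2}).

Local Notation wm := (wdeg_mon w1 w2).
Local Notation lt := (ltG le).

(** Degree conditions are predicates on the support: the zero polynomial then satisfies every upper
    bound, and cancellation in a sum does no harm to a bound. Only [wdeg_is] forces $f \neq 0$. *)
Definition wdeg_le f d := forall m, m \in msupp f -> le (wm m) d.
Definition wdeg_lt f d := forall m, m \in msupp f -> lt (wm m) d.
Definition wdeg_is f d :=
  wdeg_le f d /\ exists2 m, m \in msupp f & wm m = d.

Lemma wdeg_monD m1 m2 : wm (m1 + m2)%MM = wm m1 + wm m2.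
Proof. by rewrite /wdeg_mon !mnmDE !mulrnDr addrACA. Qed.

Lemma foldl_maxG d (s : seq Γ) :
  foldl (maxG le) d s \in d :: s
  /\ forall e, e \in d :: s -> le e (foldl (maxG le) d s).
Proof.
elim: s d => [|x s IHs] d /=.
  by split=> [|e]; rewrite inE // => /eqP->; exact: leG_refl.
have [m1 m2] := IHs (maxG le d x); split.
  move: m1; rewrite !inE => /orP[/eqP->|->]; last by rewrite !orbT.
  by rewrite /maxG; case: ifP; rewrite eqxx ?orbT.
have lem : le d (maxG le d x) /\ le x (maxG le d x).
  rewrite /maxG; case: ifP => [dx|dx]; split=> //; try exact: leG_refl.
  by case: (leGVltG Hle d x) => [|/ltGW//]; rewrite dx.
have top := m2 _ (mem_head _ _).
move=> e; rewrite !inE => /or3P[/eqP->|/eqP->|es].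
- exact: (leG_trans Hle lem.1 top).
- exact: (leG_trans Hle lem.2 top).
- by apply: m2; rewrite inE es orbT.
Qed.

Lemma wdegP f : f != 0 -> wdeg_is f (wdeg le w1 w2 f).
Proof.
rewrite -msupp_eq0 /wdeg_is /wdeg_le /wdeg; case: (msupp f) => [//|x s] _ /=.
have [m1 m2] := foldl_maxG (wm x) [seq wm m | m <- s].
split=> [m ms|]; first by apply: m2; rewrite -map_cons map_f.
by move: m1; rewrite -map_cons => /mapP[m ms ->]; exists m.
Qed.

Lemma wdeg_is_neq0 f d : wdeg_is f d -> f != 0.
Proof. by case=> _ [m mf _]; apply: contraTneq mf => ->; rewrite msupp0. Qed.

Lemma wdeg_is_inj f d e : wdeg_is f d -> wdeg_is f e -> d = e.
Proof.
move=> [led [m1 s1 ed]] [lee [m2 s2 ee]].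
case: Hle => _ anti _ _ _; apply: anti.
by rewrite -{1}ed -{2}ee lee ?led.
Qed.

Lemma wdeg_isE f d : wdeg_is f d -> wdeg le w1 w2 f = d.
Proof. by move=> fd; apply: (wdeg_is_inj _ fd); apply/wdegP/(wdeg_is_neq0 fd). Qed.

(** The hypothesis [le 0 d] covers $f = 0$, where [wdeg] takes its default value 0. *)
Lemma wdeg_leE f d : le 0 d -> wdeg_le f d -> le (wdeg le w1 w2 f) d.
Proof.
move=> d0 fd; have [->|/wdegP[_ [m mf <-]]] := eqVneq f 0; last exact: fd.
by rewrite /wdeg msupp0.
Qed.

Lemma wdeg_ltE f d : lt 0 d -> wdeg_lt f d -> lt (wdeg le w1 w2 f) d.
Proof.
move=> d0 fd; have [->|/wdegP[_ [m mf <-]]] := eqVneq f 0; last exact: fd.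
by rewrite /wdeg msupp0.
Qed.

Lemma wdeg_le_trans f d e : wdeg_le f d -> le d e -> wdeg_le f e.
Proof. by move=> fd de m /fd H; apply: leG_trans de. Qed.

Lemma wdeg_le_lt f d e : wdeg_le f d -> lt d e -> wdeg_lt f e.
Proof. by move=> fd de m /fd H; apply: leG_lt_trans de. Qed.

Lemma wdeg_ltW f d : wdeg_lt f d -> wdeg_le f d.
Proof. by move=> fd m /fd /ltGW. Qed.

Lemma wdeg_leD f g d : wdeg_le f d -> wdeg_le g d -> wdeg_le (f + g) d.
Proof. by move=> fd gd m /msuppD_le; rewrite mem_cat => /orP[/fd|/gd]. Qed.

Lemma wdeg_ltD f g d : wdeg_lt f d -> wdeg_lt g d -> wdeg_lt (f + g) d.
Proof. by move=> fd gd m /msuppD_le; rewrite mem_cat => /orP[/fd|/gd]. Qed.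

Lemma wdeg_leZ c f d : wdeg_le f d -> wdeg_le (c *: f) d.
Proof. by move=> fd m /msuppZ_le /fd. Qed.

Lemma wdeg_ltZ c f d : wdeg_lt f d -> wdeg_lt (c *: f) d.
Proof. by move=> fd m /msuppZ_le /fd. Qed.

Lemma wdeg_mon0 : wm 0%MM = 0.
Proof. by rewrite /wdeg_mon !mnm0E !mulr0n addr0. Qed.

Lemma wdeg_leC c d : le 0 d -> wdeg_le c%:MP d.
Proof.
move=> d0 m; rewrite msuppC; case: ifP => // _; rewrite inE => /eqP->.
by rewrite wdeg_mon0.
Qed.

Lemma wdeg_ltC c d : lt 0 d -> wdeg_lt c%:MP d.
Proof.
move=> d0 m; rewrite msuppC; case: ifP => // _; rewrite inE => /eqP->.
by rewrite wdeg_mon0.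
Qed.

Lemma wdeg_isX i : wdeg_is 'X_i (wm U_(i)%MM).
Proof.
split=> [m|]; last by exists U_(i)%MM; rewrite // msuppX inE.
by rewrite msuppX inE => /eqP ->; exact: leG_refl.
Qed.

Lemma wdeg_isC c : c != 0 -> wdeg_is c%:MP 0.
Proof.
move=> c0; split; first by apply: wdeg_leC; exact: leG_refl.
by exists 0%MM; rewrite ?wdeg_mon0 // msuppC (negbTE c0) inE.
Qed.

Lemma wdeg_isZ c f d : c != 0 -> wdeg_is f d -> wdeg_is (c *: f) d.
Proof.
move=> c0 [fd [m mf md]]; split; first exact: wdeg_leZ.
by exists m => //; rewrite (perm_mem (msuppZ _ c0)).
Qed.

(** A monomial of [f] of degree exactly [d] does not occur in [g], so its coefficient survives in
    the sum. *)
Lemma wdeg_is_addlt f g d : wdeg_is f d -> wdeg_lt g d -> wdeg_is (f + g) d.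
Proof.
move=> [fd [m mf md]] gd; split; first by apply: wdeg_leD => //; apply: wdeg_ltW.
exists m => //; rewrite mcoeff_msupp mcoeffD (_ : g@_m = 0).
  by rewrite addr0 -mcoeff_msupp.
apply: contraTeq isT; rewrite -mcoeff_msupp => /gd.
by rewrite md ltGxx.
Qed.

Lemma wdeg_leM f g d e : wdeg_le f d -> wdeg_le g e -> wdeg_le (f * g) (d + e).
Proof.
move=> fd ge m /msuppM_le /allpairsP[[m1 m2] /= [/fd H1 /ge H2 ->]].
by rewrite wdeg_monD leG_add.
Qed.

Lemma wdeg_ltM f g d e : wdeg_lt f d -> wdeg_le g e -> wdeg_lt (f * g) (d + e).
Proof.
move=> fd ge m /msuppM_le /allpairsP[[m1 m2] /= [/fd H1 /ge H2 ->]].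
by rewrite wdeg_monD ltG_le_add.
Qed.

(* The leading form, when d is the w-degree of f. *)
Definition wtop f d := \sum_(m <- msupp f | wm m == d) f@_m *: 'X_[m].

Lemma mcoeff_wtop f d m : (wtop f d)@_m = if wm m == d then f@_m else 0.
Proof.
have E k : (if wm k == d then f@_k *: 'X_[k] else 0 : {mpoly R[2]})@_m
    = if k == m then if wm m == d then f@_m else 0 else 0.
  have [->|/negbTE nkm] := eqVneq k m.
    by case: ifP; rewrite ?mcoeff0 // mcoeffZ mcoeffX eqxx mulr1.
  by case: ifP; rewrite ?mcoeff0 // mcoeffZ mcoeffX nkm mulr0.
rewrite /wtop big_mkcond raddf_sum /= (eq_bigr _ (fun k _ => E k)).
case: (boolP (m \in msupp f)) => mf.
  rewrite (bigD1_seq m) ?msupp_uniq //= eqxx big1 ?addr0 // => k /negbTE-> //.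
rewrite (memN_msupp_eq0 mf) if_same big1_seq // => k _.
by rewrite if_same.
Qed.

Lemma wdeg_top f d m : m \in msupp (wtop f d) -> wm m = d.
Proof.
rewrite mcoeff_msupp mcoeff_wtop.
by have [//|_] := eqVneq (wm m) d; rewrite eqxx.
Qed.

Lemma wdeg_le_top f d : wdeg_le (wtop f d) d.
Proof. by move=> m /wdeg_top ->; exact: leG_refl. Qed.

Lemma wdeg_sub_top f d : wdeg_le f d -> wdeg_lt (f - wtop f d) d.
Proof.
move=> fd m; rewrite mcoeff_msupp mcoeffB mcoeff_wtop.
have [_|nd] := eqVneq (wm m) d; first by rewrite subrr eqxx.
by rewrite subr0 -mcoeff_msupp => /fd; rewrite /ltG nd andbT.
Qed.

Lemma wtop_neq0 f d : wdeg_is f d -> wtop f d != 0.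
Proof.
move=> [_ [m mf md]]; apply: contraTneq mf => t0.
by move: (mcoeff_wtop f d m); rewrite t0 mcoeff0 md eqxx mcoeff_msupp => <-; rewrite eqxx.
Qed.

(** Since $R$ is a domain, the product of the two leading forms is nonzero; all its monomials have
    degree $d+e$, and the rest of $fg$ lies strictly below. *)
Lemma wdeg_isM f g d e : wdeg_is f d -> wdeg_is g e -> wdeg_is (f * g) (d + e).
Proof.
move=> fd ge; have tfg : wtop f d * wtop g e != 0.
  by rewrite mulf_neq0 ?wtop_neq0.
have -> : f * g = wtop f d * wtop g e
    + ((f - wtop f d) * g + (g - wtop g e) * wtop f d) by ring.
have [fd' _] := fd; have [ge' _] := ge.
apply: wdeg_is_addlt; last first.
  apply: wdeg_ltD; first exact: wdeg_ltM (wdeg_sub_top fd') ge'.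
  by rewrite [d + e]addrC; apply: wdeg_ltM (wdeg_sub_top ge') (@wdeg_le_top _ _).
split; first by apply: wdeg_leM; exact: wdeg_le_top.
have [m mt] : exists m, m \in msupp (wtop f d * wtop g e).
  move: tfg; rewrite -msupp_eq0; case: (msupp _) => [//|m s] _.
  by exists m; rewrite mem_head.
exists m => //; have /allpairsP[[m1 m2] /= [t1 t2 ->]] := msuppM_le mt.
by rewrite wdeg_monD (wdeg_top t1) (wdeg_top t2).
Qed.

End WeightedDegree.

(** * Substitution of a bivariate polynomial into a univariate one *)

Definition phorner (R : idomainType) (p : {poly R}) (f : {mpoly R[2]}) : {mpoly R[2]} :=
  (map_poly (@mpolyC 2 R) p).[f].

Section Phorner.
Context (R : idomainType).
Implicit Types (p q : {poly R}) (f g : {mpoly R[2]}).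

Lemma phornerC c f : phorner c%:P f = c%:MP.
Proof. by rewrite /phorner map_polyC hornerC. Qed.

Lemma phornerD p q f : phorner (p + q) f = phorner p f + phorner q f.
Proof. by rewrite /phorner rmorphD hornerD. Qed.

Lemma phornerN p f : phorner (- p) f = - phorner p f.
Proof. by rewrite /phorner rmorphN hornerN. Qed.

Lemma phornerM p q f : phorner (p * q) f = phorner p f * phorner q f.
Proof. by rewrite /phorner rmorphM hornerM. Qed.

Lemma phornerX f : phorner 'X f = f.
Proof. by rewrite /phorner map_polyX hornerX. Qed.

Lemma phornerZ c p f : phorner (c *: p) f = c *: phorner p f.
Proof. by rewrite -mul_polyC phornerM phornerC mul_mpolyC. Qed.

Lemma phorner_comp p q f : phorner (p \Po q) f = phorner p (phorner q f).
Proof. by rewrite /phorner map_comp_poly horner_comp. Qed.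

Lemma comp_mpoly_phorner p f (phi : endo R) :
  phorner p f \mPo phi = phorner p (f \mPo phi).
Proof.
elim/poly_ind: p => [|p c IHp]; first by rewrite -polyC0 !phornerC comp_mpolyC.
by rewrite !(phornerD, phornerM, phornerC, phornerX, rmorphD, rmorphM) /= comp_mpolyC IHp.
Qed.

End Phorner.

Section WeightedDegreePhorner.
Context (R : idomainType) (Γ : zmodType) (le : rel Γ).
Context (Hle : total_order_compat le) (w1 w2 : Γ).
Implicit Types (p : {poly R}) (f : {mpoly R[2]}).

(** Used when the lighter variable has nonpositive weight: powers of [f] then stay in degree at most
    0, whatever the degree of [p]. *)
Lemma wdeg_le_phorner p f : wdeg_le le w1 w2 f 0 -> wdeg_le le w1 w2 (phorner p f) 0.
Proof.
move=> f0; elim/poly_ind: p => [|p c IHp].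
  by rewrite -polyC0 phornerC; apply: wdeg_leC; exact: leG_refl.
rewrite phornerD phornerM phornerC phornerX; apply: wdeg_leD.
  by rewrite -[0]addr0; apply: wdeg_leM.
by apply: wdeg_leC; exact: leG_refl.
Qed.

(** As $d > 0$, the powers of [f] have strictly increasing degrees, so the leading term of [p]
    decides. In Horner form, each step multiplies by [f], and the product has positive degree, above
    that of the added constant. *)
Lemma wdeg_is_phorner p f d : p != 0 -> ltG le 0 d -> wdeg_is le w1 w2 f d ->
  wdeg_is le w1 w2 (phorner p f) (d *+ (size p).-1).
Proof.
move=> + d0 fd; elim/poly_ind: p => [|p c IHp]; first by rewrite eqxx.
rewrite size_MXaddC phornerD phornerM phornerC phornerX.
(* Here the whole polynomial is the nonzero constant [c], of degree $0 = d \cdot 0$. *)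
have [-> nc|p0 _] := eqVneq p 0.
  have c0 : c != 0 by move: nc; rewrite mul0r add0r polyC_eq0.
  rewrite -[X in phorner X]polyC0 phornerC mpolyC0 mul0r add0r (negbTE c0) andbF.
  by rewrite size_poly0; apply: wdeg_isC.
rewrite andFb /=.
have -> : d *+ size p = d *+ (size p).-1 + d.
  by rewrite -mulrSr prednK // lt0n size_poly_eq0.
apply: wdeg_is_addlt => //; first by apply: wdeg_isM => //; apply: IHp.
apply: wdeg_ltC; case: (posnP (size p).-1) => [->|sp]; first by rewrite add0r.
by have := ltG_le_add Hle (mulrn_gtG0 Hle d0 sp) (ltGW d0); rewrite addr0.
Qed.

(** Every monomial in the support has exponent 0 at [i], because the substituted polynomial involves
    $x_j$ only. *)
Lemma mcoeff_phornerU p (i j : 'I_2) (v c : R) : i != j ->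
  (phorner p (v *: 'X_j + c%:MP))@_U_(i) = 0.
Proof.
move=> ij; set b := v *: _ + _.
have bi m : m \in msupp b -> m i = 0%N.
  move/msuppD_le; rewrite mem_cat => /orP[/msuppZ_le|].
    by rewrite msuppX inE => /eqP->; rewrite mnm1E eq_sym (negbTE ij).
  by rewrite msuppC; case: ifP => // _; rewrite inE => /eqP->; rewrite mnm0E.
have pi m : m \in msupp (phorner p b) -> m i = 0%N.
  elim/poly_ind: p m => [|p k IHp] m; first by rewrite -polyC0 phornerC msuppC eqxx.
  rewrite phornerD phornerM phornerC phornerX => /msuppD_le.
  rewrite mem_cat => /orP[/msuppM_le/allpairsP[[m1 m2] /= [/IHp H1 /bi H2 ->]]|].
    by rewrite mnmDE H1 H2.
  by rewrite msuppC; case: ifP => // _; rewrite inE => /eqP->; rewrite mnm0E.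
apply: contraTeq isT; rewrite -mcoeff_msupp => /pi.
by rewrite mnm1E eqxx.
Qed.

End WeightedDegreePhorner.

(** * Endomorphisms of R[x1, x2] *)

Definition endo2 (R : nzRingType) (f g : {mpoly R[2]}) : endo R := [tuple f; g].

Local Notation i0 := (ord0 : 'I_2).
Local Notation i1 := (Ordinal (isT : (1 < 2)%N)).

Lemma ord2P (i : 'I_2) : i = i0 \/ i = i1.
Proof. by case: i => [[|[|//]] Hi]; [left | right]; apply: val_inj. Qed.

Section Endomorphisms.
Context (R : idomainType).
Implicit Types (p q : {poly R}) (f g : {mpoly R[2]}) (phi psi chi : endo R).
Implicit Types (a b c d e : R).

Local Notation X0 := ('X_i0 : {mpoly R[2]}).
Local Notation X1 := ('X_i1 : {mpoly R[2]}).

Lemma endoE phi psi :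
  tnth phi i0 = tnth psi i0 -> tnth phi i1 = tnth psi i1 -> phi = psi.
Proof. by move=> e0 e1; apply: eq_from_tnth => i; case: (ord2P i) => ->. Qed.

Lemma tnth_endo2 f g : (tnth (endo2 f g) i0 = f) * (tnth (endo2 f g) i1 = g).
Proof. by []. Qed.

Lemma endo2_eta phi : phi = endo2 (tnth phi i0) (tnth phi i1).
Proof. exact: endoE. Qed.

Lemma idE_endo2 : idE R = endo2 X0 X1.
Proof. by apply: endoE; rewrite tnth_mktuple. Qed.

Lemma tnth_endo_comp phi psi i : tnth (endo_comp phi psi) i = tnth psi i \mPo phi.
Proof. by rewrite tnth_mktuple. Qed.

Lemma endo_comp_endo2 phi f g : endo_comp phi (endo2 f g) = endo2 (f \mPo phi) (g \mPo phi).
Proof. by apply: endoE; rewrite tnth_endo_comp. Qed.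

Lemma comp_mpolyXE (i : 'I_2) phi : 'X_i \mPo phi = tnth phi i.
Proof. by rewrite comp_mpolyXU -tnth_nth. Qed.

Lemma endo_comp1 phi : endo_comp phi (idE R) = phi.
Proof.
by apply: endoE; rewrite tnth_endo_comp tnth_mktuple comp_mpolyXE.
Qed.

Lemma endo_1comp phi : endo_comp (idE R) phi = phi.
Proof. by apply: endoE; rewrite tnth_endo_comp comp_mpoly_id. Qed.

Lemma comp_mpolyA f phi psi : (f \mPo psi) \mPo phi = f \mPo (endo_comp phi psi).
Proof.
rewrite [f \mPo psi]comp_mpolyEX [RHS]comp_mpolyEX raddf_sum /=.
apply: eq_bigr => m _; rewrite comp_mpolyZ !comp_mpolyX rmorph_prod /=.
congr (_ *: _); apply: eq_bigr => i _.
by rewrite rmorphXn /= tnth_endo_comp.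
Qed.

Lemma endo_compA phi psi chi :
  endo_comp phi (endo_comp psi chi) = endo_comp (endo_comp phi psi) chi.
Proof. by apply: endoE; rewrite !tnth_endo_comp comp_mpolyA. Qed.

Lemma is_inverse_sym phi psi : is_inverse phi psi -> is_inverse psi phi.
Proof. by case. Qed.

Lemma is_inverse_inj phi psi chi : is_inverse phi psi -> is_inverse phi chi -> psi = chi.
Proof.
move=> [_ h1] [h2 _].
by rewrite -[psi]endo_comp1 -h2 endo_compA h1 endo_1comp.
Qed.

Lemma is_inverse_comp phi phi' psi psi' : is_inverse phi phi' -> is_inverse psi psi' ->
  is_inverse (endo_comp phi psi) (endo_comp psi' phi').
Proof.
move=> [a1 a2] [b1 b2]; split.
  by rewrite endo_compA -(endo_compA phi) b1 endo_comp1.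
by rewrite endo_compA -(endo_compA psi') a2 endo_comp1.
Qed.

Lemma is_inverse_id : is_inverse (idE R) (idE R).
Proof. by split; rewrite endo_comp1. Qed.

Lemma gen_grp_aut (S : endo R -> Prop) phi : (forall psi, S psi -> is_aut psi) ->
  gen_grp S phi -> is_aut phi.
Proof.
move=> Saut; elim=> {phi} [phi /Saut//||phi psi _ [phi' h1] _ [psi' h2]|phi psi _ _ h].
- by exists (idE R); exact: is_inverse_id.
- by exists (endo_comp psi' phi'); exact: is_inverse_comp.
- by exists phi; exact: is_inverse_sym.
Qed.

Lemma gen_grp_inverse (S : endo R -> Prop) phi : (forall psi, S psi -> is_aut psi) ->
  gen_grp S phi -> exists2 psi, is_inverse phi psi & gen_grp S psi.
Proof.
move=> Saut Sphi; have [psi h] := gen_grp_aut Saut Sphi.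
by exists psi => //; apply: gen_inv h.
Qed.

Lemma Aff_aut phi : Aff phi -> is_aut phi.
Proof. by apply: gen_grp_aut => psi []. Qed.

Definition triangular a p d e : endo R := endo2 (a *: X0 + phorner p X1) (d *: X1 + e%:MP).
Definition elementary0 a p : endo R := endo2 (a *: X0 + phorner p X1) X1.
Definition elementary1 a p : endo R := endo2 X0 (a *: X1 + phorner p X0).
Definition swapE : endo R := endo2 X1 X0.

(** Composition on the right acts on the pair [(f, g)] like an elementary operation on its
    components; the formula holds for arbitrary [f] and [g]. *)
Lemma comp_elementary0 f g a p :
  endo_comp (endo2 f g) (elementary0 a p) = endo2 (a *: f + phorner p g) g.
Proof.
by rewrite endo_comp_endo2 comp_mpolyD comp_mpolyZ comp_mpoly_phorner !comp_mpolyXE.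
Qed.

Lemma comp_elementary1 f g a p :
  endo_comp (endo2 f g) (elementary1 a p) = endo2 f (a *: g + phorner p f).
Proof.
by rewrite endo_comp_endo2 comp_mpolyD comp_mpolyZ comp_mpoly_phorner !comp_mpolyXE.
Qed.

Lemma comp_triangular f g a p d e : endo_comp (endo2 f g) (triangular a p d e) =
  endo2 (a *: f + phorner p g) (d *: g + e%:MP).
Proof.
by rewrite endo_comp_endo2 !comp_mpolyD !comp_mpolyZ comp_mpoly_phorner
   !comp_mpolyXE comp_mpolyC.
Qed.

Lemma comp_swapE f g : endo_comp (endo2 f g) swapE = endo2 g f.
Proof. by rewrite endo_comp_endo2 !comp_mpolyXE. Qed.

Lemma swapEK : endo_comp swapE swapE = idE R.
Proof. by rewrite comp_swapE idE_endo2. Qed.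

Lemma is_inverse_swapE : is_inverse swapE swapE.
Proof. by split; exact: swapEK. Qed.

(** Reduces statements about the second variable to those about the first. *)
Lemma elementary1_conj a p :
  elementary1 a p = endo_comp swapE (endo_comp (elementary0 a p) swapE).
Proof.
by rewrite comp_swapE endo_comp_endo2 comp_mpolyD comp_mpolyZ comp_mpoly_phorner
  !comp_mpolyXE.
Qed.

Lemma triangularE a p d e :
  triangular a p d e = endo_comp (elementary0 a p) (elementary1 d e%:P).
Proof. by rewrite comp_elementary1 phornerC. Qed.

Lemma triangular_elementary0 a p : triangular a p 1 0 = elementary0 a p.
Proof. by rewrite /triangular scale1r mpolyC0 addr0. Qed.

Lemma is_inverse_elementary0 a p : a \is a GRing.unit ->
  is_inverse (elementary0 a p) (elementary0 a^-1 (- a^-1 *: p)).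
Proof.
move=> ua; split; rewrite comp_elementary0 phornerZ idE_endo2; congr (endo2 _ _).
  by rewrite scalerDr scalerA mulVr // scale1r scaleNr addrK.
by rewrite scalerDr !scalerA mulrN divrr // scale1r scaleN1r subrK.
Qed.

Lemma elementary0_in_Aut a p : a \is a GRing.unit -> in_Aut_over_A i0 (elementary0 a p).
Proof.
move=> ua; split; first by eexists; exact: is_inverse_elementary0.
by move=> j; case: (ord2P j) => ->.
Qed.

Lemma elementary1_in_Aut a p : a \is a GRing.unit -> in_Aut_over_A i1 (elementary1 a p).
Proof.
move=> ua; split; last by move=> j; case: (ord2P j) => ->.
rewrite elementary1_conj; eexists; apply: (is_inverse_comp is_inverse_swapE).
exact: (is_inverse_comp (is_inverse_elementary0 p ua) is_inverse_swapE).
Qed.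

Lemma triangular_comp a p d e a' p' d' e' :
  endo_comp (triangular a p d e) (triangular a' p' d' e') =
  triangular (a' * a) (a' *: p + (p' \Po (d *: 'X + e%:P))) (d' * d) (d' * e + e').
Proof.
rewrite {1}/triangular comp_triangular /triangular !scalerDr !scalerA; congr (endo2 _ _).
  by rewrite !phornerD phornerZ phorner_comp phornerD phornerZ phornerX phornerC addrA.
by rewrite -addrA -(mul_mpolyC d' e%:MP) -mpolyCM -mpolyCD.
Qed.

(** * Affine endomorphisms in coordinates *)

Definition lin2 a b c : {mpoly R[2]} := a *: X0 + b *: X1 + c%:MP.

Definition affE a b c a' b' c' := endo2 (lin2 a b c) (lin2 a' b' c').

Lemma lin2_coef0 a b c : (lin2 a b c)@_U_(i0) = a.
Proof.
rewrite /lin2 !mcoeffD !mcoeffZ !mcoeffXU mcoeffC !eqxx /= mulr1 mulr0.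
by rewrite mnm1_eq0 mulr0 !addr0.
Qed.

Lemma lin2_coef1 a b c : (lin2 a b c)@_U_(i1) = b.
Proof.
rewrite /lin2 !mcoeffD !mcoeffZ !mcoeffXU mcoeffC !eqxx /= mulr1 mulr0.
by rewrite mnm1_eq0 mulr0 addr0 add0r.
Qed.

Lemma lin2_coefC a b c : (lin2 a b c)@_0%MM = c.
Proof.
rewrite /lin2 !mcoeffD !mcoeffZ !mcoeffX mcoeffC !mnm1_eq0 /= !mulr0 !add0r.
by rewrite eqxx mulr1.
Qed.

Lemma lin2_coef_gt1 a b c m : (1 < mdeg m)%N -> (lin2 a b c)@_m = 0.
Proof.
move=> m1; rewrite /lin2 !mcoeffD !mcoeffZ !mcoeffX mcoeffC.
have nU i : (U_(i)%MM == m) = false.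
  by apply: contraTF m1 => /eqP <-; rewrite mdeg1.
have -> : (m == 0%MM) = false by apply: contraTF m1 => /eqP ->; rewrite mdeg0.
by rewrite !nU !mulr0 !addr0.
Qed.

Lemma lin2P f : (forall m, (1 < mdeg m)%N -> f@_m = 0) ->
  f = lin2 f@_U_(i0) f@_U_(i1) f@_0%MM.
Proof.
move=> Hf; apply/mpolyP => m.
case: (ltnP 1 (mdeg m)) => m1; first by rewrite Hf // lin2_coef_gt1.
move: m1; rewrite leq_eqVlt ltnS leqn0 mdeg_eq0 => /orP[/mdeg1P[i /eqP->]|/eqP->].
  by case: (ord2P i) => ->; rewrite ?lin2_coef0 ?lin2_coef1.
by rewrite lin2_coefC.
Qed.

Lemma msize_lin2 a b c : (a != 0) || (b != 0) -> msize (lin2 a b c) = 2%N.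
Proof.
move=> ab; apply/eqP; rewrite eqn_leq; apply/andP; split.
  rewrite msizeE; apply/bigmax_leqP_seq => m mf _; rewrite ltnS leqNgt.
  by apply: contraL mf => /lin2_coef_gt1; rewrite mcoeff_msupp => ->; rewrite eqxx.
have [i nz] : exists i, (lin2 a b c)@_U_(i) != 0.
  by case/orP: ab; [exists i0; rewrite lin2_coef0 | exists i1; rewrite lin2_coef1].
by have := @msize_mdeg_lt _ _ (lin2 a b c) U_(i)%MM; rewrite mdeg1 mcoeff_msupp; apply.
Qed.

Lemma comp_lin2 a b c f g : lin2 a b c \mPo endo2 f g = a *: f + b *: g + c%:MP.
Proof. by rewrite !comp_mpolyD !comp_mpolyZ !comp_mpolyXE comp_mpolyC. Qed.

Lemma lin2_comb a b c a1 b1 c1 a2 b2 c2 :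
  a *: lin2 a1 b1 c1 + b *: lin2 a2 b2 c2 + c%:MP =
  lin2 (a * a1 + b * a2) (a * b1 + b * b2) (a * c1 + b * c2 + c).
Proof.
rewrite /lin2 -!mul_mpolyC !mpolyCD !mpolyCM; ring.
Qed.

Lemma lin2_inj a b c a' b' c' : lin2 a b c = lin2 a' b' c' -> [/\ a = a', b = b' & c = c'].
Proof.
move=> E; split; first by rewrite -(lin2_coef0 a b c) E lin2_coef0.
  by rewrite -(lin2_coef1 a b c) E lin2_coef1.
by rewrite -(lin2_coefC a b c) E lin2_coefC.
Qed.

Lemma X0_lin2 : X0 = lin2 1 0 0.
Proof. by rewrite /lin2 scale1r scale0r mpolyC0 !addr0. Qed.

Lemma X1_lin2 : X1 = lin2 0 1 0.
Proof. by rewrite /lin2 scale1r scale0r mpolyC0 addr0 add0r. Qed.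

Lemma idE_affE : idE R = affE 1 0 0 0 1 0.
Proof. by rewrite idE_endo2 X0_lin2 X1_lin2. Qed.

Lemma endo2_inj f g f' g' : endo2 f g = endo2 f' g' -> f = f' /\ g = g'.
Proof.
move=> E; split; first exact: (congr1 (fun t : endo R => tnth t i0) E).
exact: (congr1 (fun t : endo R => tnth t i1) E).
Qed.

Lemma affE_comp a b c a' b' c' a1 b1 c1 a2 b2 c2 :
  endo_comp (affE a b c a' b' c') (affE a1 b1 c1 a2 b2 c2) =
  affE (a1 * a + b1 * a') (a1 * b + b1 * b') (a1 * c + b1 * c' + c1)
       (a2 * a + b2 * a') (a2 * b + b2 * b') (a2 * c + b2 * c' + c2).
Proof. by rewrite endo_comp_endo2 !comp_lin2 !lin2_comb. Qed.

(** Cramer's rule: the determinant times each component of [psi] is affine. The determinant is not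
    yet known to be a unit, but it is nonzero, and over a domain this already kills the coefficients
    of [psi] in degree above 1. *)
Lemma affE_inverse a b c a' b' c' psi : is_inverse (affE a b c a' b' c') psi ->
  exists a1 b1 c1 a2 b2 c2, psi = affE a1 b1 c1 a2 b2 c2.
Proof.
case=> _; rewrite [psi]endo2_eta; set g := tnth psi i0; set h := tnth psi i1.
rewrite endo_comp_endo2 !comp_lin2 idE_endo2 => /endo2_inj[E0 E1].
have Eg : (a * b' - b * a') *: g = lin2 b' (- b) (b * c' - b' * c).
  rewrite /lin2 -E0 -E1 -!mul_mpolyC !(mpolyCD, mpolyCM, mpolyCN); ring.
have Eh : (a * b' - b * a') *: h = lin2 (- a') a (a' * c - a * c').
  rewrite /lin2 -E0 -E1 -!mul_mpolyC !(mpolyCD, mpolyCM, mpolyCN); ring.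
have det0 : a * b' - b * a' != 0.
  (* A zero determinant would make the right-hand sides of [Eg] and [Eh] vanish, hence $a = b = 0$,
     and $x_1$ would be the constant [c]. *)
  apply/negP => /eqP det0; rewrite det0 !scale0r in Eg Eh.
  have z : 0 = lin2 0 0 0 by rewrite /lin2 !scale0r mpolyC0 !addr0.
  have [_ b0 _] := lin2_inj (etrans (esym z) Eg).
  have [_ a0 _] := lin2_inj (etrans (esym z) Eh).
  move: E0; rewrite -a0 (_ : b = 0) ?scale0r; last by rewrite -[b]opprK -b0 oppr0.
  rewrite !add0r X0_lin2 => E0.
  have : (c%:MP : {mpoly R[2]}) = lin2 0 0 c by rewrite /lin2 !scale0r !add0r.
  by rewrite E0 => /lin2_inj[/eqP]; rewrite oner_eq0.
have aff f u v w : (a * b' - b * a') *: f = lin2 u v w ->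
    f = lin2 f@_U_(i0) f@_U_(i1) f@_0%MM.
  move=> Ef; apply: lin2P => m m1; apply/eqP.
  have /eqP : ((a * b' - b * a') *: f)@_m = 0 by rewrite Ef lin2_coef_gt1.
  by rewrite mcoeffZ mulf_eq0 (negbTE det0).
by rewrite (aff g _ _ _ Eg) (aff h _ _ _ Eh); do 6 eexists.
Qed.

(** The inverse is affine too, and the determinants of the two multiply to 1. *)
Lemma affE_det a b c a' b' c' : is_aut (affE a b c a' b' c') ->
  a * b' - b * a' \is a GRing.unit.
Proof.
move=> [psi inv]; have [a1 [b1 [c1 [a2 [b2 [c2 E]]]]]] := affE_inverse inv.
case: inv => + _; rewrite E affE_comp idE_affE => /endo2_inj[].
move=> /lin2_inj[e1 e2 _] /lin2_inj[e3 e4 _].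
apply/unitrP; exists (a1 * b2 - b1 * a2).
suff D : (a1 * b2 - b1 * a2) * (a * b' - b * a') = 1 by split=> //; rewrite mulrC.
transitivity ((a1 * a + b1 * a') * (a2 * b + b2 * b') -
  (a1 * b + b1 * b') * (a2 * a + b2 * a')); first by ring.
by rewrite e1 e2 e3 e4; ring.
Qed.

Lemma Aff_affE phi : Aff phi -> exists a b c a' b' c', phi = affE a b c a' b' c'.
Proof.
elim=> {phi} [phi [_ sz]|||].
(* [msize] is the total degree plus one, so all coefficients in degree above 1 vanish. *)
- have aff i : tnth phi i = lin2 (tnth phi i)@_U_(i0) (tnth phi i)@_U_(i1) (tnth phi i)@_0%MM.
    apply: lin2P => m m1; apply: memN_msupp_eq0; apply: msize_mdeg_ge.
    by rewrite sz.
  by rewrite [phi]endo2_eta (aff i0) (aff i1); do 6 eexists.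
- by rewrite idE_affE; do 6 eexists.
- move=> phi psi _ [a [b [c [a' [b' [c' ->]]]]]] _ [a1 [b1 [c1 [a2 [b2 [c2 ->]]]]]].
  by rewrite affE_comp; do 6 eexists.
- by move=> phi psi _ [a [b [c [a' [b' [c' ->]]]]]] /affE_inverse.
Qed.

End Endomorphisms.

(** * Explicit form of the automorphisms that fix one variable *)

Section ElementaryForm.
Context (R : idomainType).
Implicit Types (f g : {mpoly R[2]}).

Local Notation X0 := ('X_i0 : {mpoly R[2]}).
Local Notation X1 := ('X_i1 : {mpoly R[2]}).

(** Reads $R[x_1,x_2]$ as $R[x_2][x_1]$: the outer variable is $x_1$, the inner one $x_2$.
    Substitutions that fix $x_2$ become compositions of univariate polynomials over the domain
    $R[x_2]$. *)
Definition to_bipoly : {mpoly R[2]} -> {poly {poly R}} :=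
  mmap (polyC \o polyC) (fun i : 'I_2 => if i == i0 then 'X else 'X%:P).

Definition of_bipoly : {poly {poly R}} -> {mpoly R[2]} :=
  horner_eval X0 \o map_poly (horner_eval X1 \o map_poly (@mpolyC 2 R)).

HB.instance Definition _ := GRing.RMorphism.on to_bipoly.
HB.instance Definition _ := GRing.RMorphism.on of_bipoly.

Lemma to_bipolyC (c : R) : to_bipoly c%:MP = c%:P%:P.
Proof. exact: mmapC. Qed.

Lemma to_bipolyX0 : to_bipoly X0 = 'X.
Proof. by rewrite /to_bipoly mmapX mmap1U eqxx. Qed.

Lemma to_bipolyX1 : to_bipoly X1 = 'X%:P.
Proof. by rewrite /to_bipoly mmapX mmap1U. Qed.

Lemma mpoly2_ind (P : {mpoly R[2]} -> Prop) :
  (forall c, P c%:MP) -> P X0 -> P X1 -> (forall f g, P f -> P g -> P (f + g)) ->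
  (forall f g, P f -> P g -> P (f * g)) -> forall f, P f.
Proof.
move=> PC P0 P1 PD PM; elim/mpolyind => [|c m f _ _ Pf].
  by rewrite -mpolyC0.
apply: PD => //; rewrite -mul_mpolyC; apply: (PM) => //.
rewrite mpolyXE_id; apply: big_rec => [|i g _ Pg]; first by rewrite -mpolyC1.
apply: (PM) => //; elim: (m i) => [|k IHk]; first by rewrite expr0 -mpolyC1.
by rewrite exprS; apply: (PM) => //; case: (ord2P i) => ->.
Qed.

Lemma to_bipolyK : cancel to_bipoly of_bipoly.
Proof.
elim/mpoly2_ind => [c|||f g Hf Hg|f g Hf Hg].
- by rewrite to_bipolyC /of_bipoly /= map_polyC /= map_polyC /horner_eval !hornerC.
- by rewrite to_bipolyX0 /of_bipoly /= map_polyX /horner_eval hornerX.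
- by rewrite to_bipolyX1 /of_bipoly /= map_polyC /= map_polyX /horner_eval hornerC hornerX.
- by rewrite (rmorphD to_bipoly) (rmorphD of_bipoly) /= Hf Hg.
- by rewrite (rmorphM to_bipoly) (rmorphM of_bipoly) /= Hf Hg.
Qed.

Lemma to_bipoly_comp f g :
  to_bipoly (f \mPo endo2 g X1) = to_bipoly f \Po to_bipoly g.
Proof.
elim/mpoly2_ind: f => [c|||f h Hf Hh|f h Hf Hh].
- by rewrite comp_mpolyC to_bipolyC comp_polyC.
- by rewrite comp_mpolyXE to_bipolyX0 comp_polyX.
- by rewrite comp_mpolyXE to_bipolyX1 comp_polyC.
- by rewrite (rmorphD (comp_mpoly _)) !(rmorphD to_bipoly) /= comp_polyD Hf Hh.
- by rewrite (rmorphM (comp_mpoly _)) !(rmorphM to_bipoly) /= comp_polyM Hf Hh.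
Qed.

(** Over the domain $R[x_2]$, an identity $F \circ G = X$ forces $\deg F \cdot \deg G = 1$. The
    leading coefficients then multiply to 1, and a unit of $R[x_2]$ is a constant that is a unit of
    $R$. *)
Lemma in_Aut_elementary0 (phi : endo R) : in_Aut_over_A i0 phi ->
  exists a p, a \is a GRing.unit /\ phi = elementary0 a p.
Proof.
move=> [[psi [_ h]] /(_ i1 isT) E1]; move: h.
rewrite [phi]endo2_eta E1 [psi]endo2_eta endo_comp_endo2 idE_endo2 => /endo2_inj[].
set f := tnth phi _ => h0; rewrite comp_mpolyXE => h1; move: h0.
rewrite [tnth psi i1]h1; set g := tnth psi _ => /(congr1 to_bipoly).
rewrite to_bipoly_comp to_bipolyX0; set F := to_bipoly f; set G := to_bipoly g => FG.
have [sF sG] : (size F = 2 /\ size G = 2)%N.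
  have /esym/eqP := size_comp_poly F G; rewrite FG size_polyX muln_eq1.
  by case: (size F) => [|[|[]]] //; case: (size G) => [|[|[]]].
have uF : lead_coef F \is a GRing.unit.
  apply/unitrPr; exists (lead_coef G).
  by have := @lead_coef_comp _ F G; rewrite sG FG lead_coefX sF expr1 => ->.
move: uF; rewrite poly_unitE lead_coefE sF /= => /andP[/size_poly1P[a a0 Ea]].
rewrite Ea coefC /= => ua; exists a, F`_0; split=> //.
have FE : F = (F`_0)%:P + a%:P%:P * 'X.
  apply/polyP => k; rewrite coefD coefC coefCM coefX.
  case: k => [|[|k]]; rewrite /= ?mulr0 ?addr0 ?mulr1 ?add0r //.
  by rewrite nth_default // sF.
rewrite /elementary0; congr endo2.
rewrite -[f]to_bipolyK -/F FE coefD coefMX coefC /= addr0 rmorphD rmorphM /= addrC.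
rewrite /of_bipoly /= map_polyX !map_polyC /= map_polyC /horner_eval hornerX !hornerC.
by rewrite mul_mpolyC.
Qed.

Lemma in_Aut_elementary1 (phi : endo R) : in_Aut_over_A i1 phi ->
  exists a p, a \is a GRing.unit /\ phi = elementary1 a p.
Proof.
move=> [[psi h] /(_ i0 isT) E0].
have /in_Aut_elementary0[a [p [ua E]]] :
    in_Aut_over_A i0 (endo_comp (@swapE R) (endo_comp phi (@swapE R))).
  split; last first.
    move=> j; case: (ord2P j) => -> // _.
    by rewrite !tnth_endo_comp !comp_mpolyXE /= E0 comp_mpolyXE.
  eexists; apply: (is_inverse_comp (is_inverse_swapE R)).
  exact: (is_inverse_comp h (is_inverse_swapE R)).
exists a, p; split=> //; rewrite elementary1_conj -E -!endo_compA swapEK endo_comp1.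
by rewrite endo_compA swapEK endo_1comp.
Qed.

End ElementaryForm.

(** * Normal forms in G^+ *)

Section NormalForm.
Context (R : idomainType) (G : endo R -> Prop) (HGaff : forall phi, G phi -> Aff phi).
Implicit Types (p q : {poly R}) (phi psi chi sigma tau g : endo R).

Lemma gen_grp_sub (S T : endo R -> Prop) phi :
  (forall psi, S psi -> gen_grp T psi) -> gen_grp S phi -> gen_grp T phi.
Proof.
move=> ST; elim=> {phi} [phi /ST//||phi psi _ h1 _ h2|phi psi _ h inv].
- exact: gen_id.
- exact: gen_comp.
- exact: gen_inv h inv.
Qed.

Lemma Gbar_Aff g : Gbar G g -> Aff g.
Proof.
by apply: gen_grp_sub => psi [/HGaff//|]; apply: gen_grp_sub => chi [? _]; apply: gen_base.
Qed.

Lemma Gbar_affE g : Gbar G g -> exists a b c a' b' c',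
  g = affE a b c a' b' c' /\ a * b' - b * a' \is a GRing.unit.
Proof.
move=> /Gbar_Aff Ag; have [a [b [c [a' [b' [c' E]]]]]] := Aff_affE Ag.
exists a, b, c, a', b', c'; split=> //; apply: (@affE_det _ a b c a' b' c').
by rewrite -E; apply: Aff_aut.
Qed.

Lemma Gbar_inverse g : Gbar G g -> exists2 h, is_inverse g h & Gbar G h.
Proof.
apply: gen_grp_inverse => psi [/HGaff /Aff_aut//|].
by apply: gen_grp_aut => chi [[]].
Qed.

Lemma Gbar_elem (i : 'I_2) g : in_Aut_over_A i g -> (forall j, msize (tnth g j) = 2%N) ->
  Gbar G g.
Proof.
move=> Ag sz; apply: gen_base; right; apply: gen_base; split; last by exists i.
by split=> //; case: Ag.
Qed.

Lemma msizeX1 (i : 'I_2) : msize ('X_i : {mpoly R[2]}) = 2%N.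
Proof. by rewrite msizeX mdeg1. Qed.

Lemma phorner_lin p (f : {mpoly R[2]}) : (size p <= 2)%N ->
  phorner p f = p`_1 *: f + (p`_0)%:MP.
Proof.
move=> sp; have {1}-> : p = (p`_0)%:P + p`_1 *: 'X.
  apply/polyP => k; rewrite coefD coefC coefZ coefX.
  case: k => [|[|k]]; rewrite /= ?mulr0 ?addr0 ?mulr1 ?add0r //.
  by rewrite nth_default // (leq_trans sp).
by rewrite phornerD phornerC phornerZ phornerX addrC.
Qed.

Lemma Gbar_elementary0 a p : a \is a GRing.unit -> (size p <= 2)%N ->
  Gbar G (elementary0 a p).
Proof.
move=> ua sp; apply: (Gbar_elem (elementary0_in_Aut p ua)) => j.
case: (ord2P j) => -> /=; last exact: msizeX1.
have := @msize_lin2 _ a p`_1 p`_0; rewrite /lin2 -addrA -phorner_lin //; apply.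
by apply/orP; left; apply: contraTneq ua => ->; rewrite unitr0.
Qed.

Lemma Gbar_elementary1 a p : a \is a GRing.unit -> (size p <= 2)%N ->
  Gbar G (elementary1 a p).
Proof.
move=> ua sp; apply: (Gbar_elem (elementary1_in_Aut p ua)) => j.
case: (ord2P j) => -> /=; first exact: msizeX1.
have := @msize_lin2 _ p`_1 a p`_0.
rewrite /lin2 [_ *: _ + a *: _]addrC -addrA -phorner_lin //; apply.
by apply/orP; right; apply: contraTneq ua => ->; rewrite unitr0.
Qed.

Lemma Gbar_triangular a p d e : a \is a GRing.unit -> d \is a GRing.unit ->
  (size p <= 2)%N -> Gbar G (triangular a p d e).
Proof.
move=> ua ud sp; rewrite triangularE; apply: gen_comp; first exact: Gbar_elementary0.
apply: Gbar_elementary1 => //; exact: leq_trans (size_polyC_leq1 _) _.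
Qed.

(** The exchange of variables is a product of three affine shears and a sign change: $(x_1,x_2)$
    becomes $(x_1+x_2,x_2)$, $(x_1+x_2,-x_1)$, $(x_2,-x_1)$ and finally $(x_2,x_1)$. So [Gbar G]
    contains it for every [G]. *)
Lemma Gbar_swapE : Gbar G (@swapE R).
Proof.
have -> : @swapE R = endo_comp (endo_comp (endo_comp (elementary0 1 'X)
    (elementary1 1 (- 'X))) (elementary0 1 'X)) (elementary1 (-1) 0).
  rewrite {1}/elementary0 comp_elementary1 comp_elementary0 comp_elementary1 /swapE.
  rewrite -polyC0 phornerC phornerN !phornerX mpolyC0 !scale1r scaleN1r addr0.
  by congr endo2; ring.
by do !apply: gen_comp; [apply: Gbar_elementary0 | apply: Gbar_elementary1
  | apply: Gbar_elementary0 | apply: Gbar_elementary1];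
  rewrite ?unitr1 ?unitrN1 ?size_polyN ?size_polyX ?size_poly0.
Qed.

(** As [size] is the degree plus one, small means that [p] is zero or of degree at most 1, so that
    the map is affine; big means degree at least 2. *)
Definition small_triangular sigma := exists a p d e,
  [/\ a \is a GRing.unit, d \is a GRing.unit, (size p <= 2)%N & sigma = triangular a p d e].

Definition big_triangular sigma := exists a p d e,
  [/\ a \is a GRing.unit, d \is a GRing.unit, (2 < size p)%N & sigma = triangular a p d e].

(* For g affine, the failure of this condition means that g is triangular. *)
Definition is_lower g := (tnth g i1)@_U_(i0) != 0.

Lemma small_triangular_Gbar sigma : small_triangular sigma -> Gbar G sigma.
Proof. by move=> [a [p [d [e [ua ud sp ->]]]]]; apply: Gbar_triangular. Qed.

Lemma size_linear_poly (d e : R) : (size ((d *: 'X + e%:P)%R : {poly R}) <= 2)%N.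
Proof.
apply: leq_trans (size_polyD _ _) _.
rewrite geq_max (leq_trans (size_scale_leq _ _)) ?size_polyX //.
exact: leq_trans (size_polyC_leq1 _) _.
Qed.

(** The [maxn 1] accounts for $p = 0$, where the general bound on the size of a composite is still
    1. *)
Lemma size_comp_linear_poly p (d e : R) :
  (size (p \Po (d *: 'X + e%:P)%R) <= maxn 1 (size p))%N.
Proof.
apply: leq_trans (size_comp_poly_leq _ _) _; have sq := size_linear_poly d e.
case: (size p) => [|n] /=; first by rewrite mul0n.
rewrite (leq_trans _ (leq_maxr _ _)) // ltnS.
by case: (size _) sq => [|[|[]]] // _; rewrite ?muln0 ?muln1.
Qed.

(** This lets a triangular affine factor be absorbed: it rescales [p] by a unit and adds terms of
    degree at most 1, so the degree of [p] is kept. *)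
Lemma big_triangular_comp_small sigma tau :
  big_triangular sigma -> small_triangular tau -> big_triangular (endo_comp sigma tau).
Proof.
move=> [a [p [d [e [ua ud sp ->]]]]] [a' [p' [d' [e' [ua' ud' sp' ->]]]]].
rewrite triangular_comp; do 4 eexists; split; try reflexivity;
  rewrite ?unitrM ?ua ?ud ?ua' ?ud' //.
have sz : size (a' *: p) = size p.
  by rewrite size_scale //; apply: contraTneq ua' => ->; rewrite unitr0.
have sc : (size (p' \Po (d *: 'X + e%:P)%R) <= 2)%N.
  by apply: leq_trans (size_comp_linear_poly _ _ _) _; rewrite geq_max.
by rewrite size_polyDl sz //; apply: leq_ltn_trans sc sp.
Qed.

Lemma triangular_case a p d e : a \is a GRing.unit -> d \is a GRing.unit ->
  small_triangular (triangular a p d e) \/ big_triangular (triangular a p d e).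
Proof.
by move=> ua ud; case: (leqP (size p) 2) => sp; [left|right]; exists a, p, d, e.
Qed.

Lemma big_triangular_comp sigma a p d e : a \is a GRing.unit -> d \is a GRing.unit ->
  big_triangular sigma -> small_triangular (endo_comp sigma (triangular a p d e)) \/
  big_triangular (endo_comp sigma (triangular a p d e)).
Proof.
move=> ua ud [a' [p' [d' [e' [ua' ud' _ ->]]]]]; rewrite triangular_comp.
by apply: triangular_case; rewrite unitrM ?ua ?ud.
Qed.

(** If the second component lacks $x_1$, the determinant is the product of the diagonal entries,
    which are therefore units. *)
Lemma Gbar_case g : Gbar G g -> is_lower g \/ small_triangular g.
Proof.
move=> /Gbar_affE[a [b [c [a' [b' [c' [-> det]]]]]]].
rewrite /is_lower /= lin2_coef0; have [a0|] := eqVneq a' 0; last by left.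
right; move: det; rewrite a0 mulr0 subr0 unitrM => /andP[ua ub].
exists a, (b *: 'X + c%:P), b', c'; split=> //.
  exact: size_linear_poly.
rewrite /affE /triangular /lin2 phornerD phornerZ phornerX phornerC scale0r add0r.
by rewrite addrA.
Qed.

(** Words $g_0 t_1 g_1 \cdots t_k g_k$ with $g_0$ arbitrary in [Gbar G] and every later $g_i$,
    including the last, lower. *)
Inductive ok_form : endo R -> Prop :=
| ok_base g : Gbar G g -> ok_form g
| ok_step chi tau g : ok_form chi -> big_triangular tau -> Gbar G g -> is_lower g ->
    ok_form (endo_comp (endo_comp chi tau) g).

(** The second alternative is a word that ends in a big triangular factor, a trailing triangular
    $g_k$ having been absorbed. *)
Definition normal_form phi := ok_form phi \/
  exists chi tau, [/\ ok_form chi, big_triangular tau & phi = endo_comp chi tau].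

(** The new factor merges with the last affine one. If the product is lower, the shape of the word
    persists; otherwise it is triangular and is absorbed by the preceding big factor. *)
Lemma ok_form_comp_Gbar chi g : ok_form chi -> Gbar G g -> normal_form (endo_comp chi g).
Proof.
move=> Hchi; elim: Hchi g => {chi} [h Gh|chi tau h okc IH bt Gh _] g Gg.
  by left; apply: ok_base; apply: gen_comp.
have Ghg : Gbar G (endo_comp h g) by apply: gen_comp.
rewrite -!endo_compA; have [lw|st] := Gbar_case Ghg.
  by left; rewrite endo_compA; apply: ok_step.
by right; exists chi, (endo_comp tau (endo_comp h g)); split=> //;
   apply: big_triangular_comp_small.
Qed.

Lemma normal_form_comp_Gbar phi g : normal_form phi -> Gbar G g -> normal_form (endo_comp phi g).
Proof.
move=> [okf|[chi [tau [okc bt ->]]]] Gg; first exact: ok_form_comp_Gbar.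
have [lw|st] := Gbar_case Gg; first by left; apply: ok_step.
right; exists chi, (endo_comp tau g); split=> //; last by rewrite endo_compA.
exact: big_triangular_comp_small.
Qed.

(** After an affine end, a big triangular factor is appended and a small one merged. After a
    triangular end, the two factors compose to a triangular map; if the polynomial parts cancel down
    to degree at most 1, that map lies in [Gbar G] and merges with the shorter word. *)
Lemma normal_form_comp_triangular phi a p d e : a \is a GRing.unit -> d \is a GRing.unit ->
  normal_form phi -> normal_form (endo_comp phi (triangular a p d e)).
Proof.
move=> ua ud [okf|[chi [tau [okc bt ->]]]].
  have [/small_triangular_Gbar|bs] := triangular_case p e ua ud.
    exact: ok_form_comp_Gbar.
  by right; exists phi, (triangular a p d e).
rewrite -endo_compA; have [/small_triangular_Gbar|bs] := big_triangular_comp p e ua ud bt.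
  exact: ok_form_comp_Gbar.
by right; eexists _, _; split; first exact: okc; first exact: bs.
Qed.

Definition stabilizes_normal_form sigma :=
  forall phi, normal_form phi -> normal_form (endo_comp phi sigma).

Lemma stabilizes_elementary0 a p : a \is a GRing.unit ->
  stabilizes_normal_form (elementary0 a p).
Proof.
move=> ua phi nf; rewrite -triangular_elementary0.
by apply: normal_form_comp_triangular; rewrite ?unitr1.
Qed.

Lemma stabilizes_elementary1 a p : a \is a GRing.unit ->
  stabilizes_normal_form (elementary1 a p).
Proof.
move=> ua phi nf; rewrite elementary1_conj !endo_compA.
apply: normal_form_comp_Gbar Gbar_swapE; apply: stabilizes_elementary0 => //.
exact: normal_form_comp_Gbar Gbar_swapE.
Qed.

Lemma is_inverse_elementary1 a p : a \is a GRing.unit ->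
  is_inverse (elementary1 a p) (elementary1 a^-1 (- a^-1 *: p)).
Proof.
move=> ua; rewrite !elementary1_conj endo_compA.
apply: is_inverse_comp (is_inverse_swapE R).
exact: is_inverse_comp (is_inverse_swapE R) (is_inverse_elementary0 p ua).
Qed.

(** Normal forms are stable under right composition with each generator, and [phi] is reached from
    the identity. Stability does not obviously pass to inverses, so the induction carries an inverse
    that is stable as well. *)
Lemma Gplus_normal_form phi : Gplus G phi -> normal_form phi.
Proof.
move=> Gphi; suff [psi [_ /(_ (idE R)) H _]] : exists psi, [/\ is_inverse phi psi,
    stabilizes_normal_form phi & stabilizes_normal_form psi].
  by move: H; rewrite endo_1comp; apply; left; apply/ok_base/gen_id.
(* Flattening the nested generation leaves single elementary automorphisms as generators, whose
   explicit form is known. *)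
have : gen_grp (fun psi => G psi \/ is_elementary psi) phi.
  apply: gen_grp_sub Gphi => psi [Gpsi|]; first by apply: gen_base; left.
  by apply: gen_grp_sub => chi echi; apply: gen_base; right.
elim=> {phi Gphi} [phi [Gphi|[i]]||phi psi _ [phi' [p1 p2 p3]] _ [psi' [q1 q2 q3]]|].
- have Gbphi : Gbar G phi by apply: gen_base; left.
  have [psi inv Gpsi] := Gbar_inverse Gbphi.
  by exists psi; split=> // chi nf; apply: normal_form_comp_Gbar.
- case: (ord2P i) => -> => [/in_Aut_elementary0|/in_Aut_elementary1] [a [p [ua ->]]].
    exists (elementary0 a^-1 (- a^-1 *: p)).
    by split; [exact: is_inverse_elementary0 | exact: stabilizes_elementary0
              | apply: stabilizes_elementary0; rewrite unitrV].
  exists (elementary1 a^-1 (- a^-1 *: p)).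
  by split; [exact: is_inverse_elementary1 | exact: stabilizes_elementary1
            | apply: stabilizes_elementary1; rewrite unitrV].
- by exists (idE R); split=> [|chi|chi]; rewrite ?endo_comp1 //; exact: is_inverse_id.
- exists (endo_comp psi' phi'); split; first exact: is_inverse_comp.
    by move=> chi /p2 /q2; rewrite endo_compA.
  by move=> chi /q3 /p3; rewrite endo_compA.
- move=> phi psi _ [psi' [p1 p2 p3]] inv; exists phi; split=> //; first exact: is_inverse_sym.
  by rewrite (is_inverse_inj inv p1).
Qed.

End NormalForm.

(** * Degree growth along normal forms *)

Section Growth.
Context (R : idomainType) (G : endo R -> Prop) (HGaff : forall phi, G phi -> Aff phi).
Context (Γ : zmodType) (le : rel Γ) (Hle : total_order_compat le) (w1 w2 : Γ).
Context (Hw : ltG le 0 w1 \/ ltG le 0 w2).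
Implicit Types (f : {mpoly R[2]}) (g phi chi tau : endo R).

Local Notation lt := (ltG le).
Local Notation wt i := (wdeg_mon w1 w2 U_(i)%MM).
Local Notation deg_is := (wdeg_is le w1 w2).
Local Notation deg_le := (wdeg_le le w1 w2).
Local Notation deg_lt := (wdeg_lt le w1 w2).

Lemma wt0 : wt i0 = w1.
Proof. by rewrite /wdeg_mon !mnm1E addr0. Qed.

Lemma wt1 : wt i1 = w2.
Proof. by rewrite /wdeg_mon !mnm1E add0r. Qed.

(** The heavier variable has positive weight because some weight is positive; the lighter one may
    have zero or negative weight. *)
Lemma exists_heavy : exists i j : 'I_2,
  [/\ i != j, le (wt j) (wt i), lt 0 (wt i) & wt i + wt j = w1 + w2].
Proof.
case: (leGVltG Hle w1 w2) => [w12|/ltGW w21].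
  exists i1, i0; rewrite wt0 wt1 addrC; split=> //.
  by case: Hw => // w0; apply: (ltG_le_trans Hle w0).
exists i0, i1; rewrite wt0 wt1; split=> //.
by case: Hw => // w0; apply: (ltG_le_trans Hle w0).
Qed.

(** State before a triangular factor: [p] is evaluated at the second component, which must have
    positive degree, and no less than the first, for a [p] of degree at least 2 to take over. *)
Definition growing chi := exists d,
  [/\ deg_is (tnth chi i1) d, lt 0 d & deg_le (tnth chi i0) d].

(** State after a triangular factor. *)
Definition dominated chi := exists d,
  [/\ deg_is (tnth chi i0) d, lt 0 d & deg_lt (tnth chi i1) d].

(* The starting state of the header, with x_i the heavier variable. *)
Definition initial chi := exists (i j : 'I_2) (v c : R),
  [/\ i != j, le (wt j) (wt i), lt 0 (wt i) & wt i + wt j = w1 + w2] /\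
  [/\ deg_le (tnth chi i0) (wt i), (tnth chi i0)@_U_(i) != 0,
      tnth chi i1 = v *: 'X_j + c%:MP & v != 0].

Lemma deg_le_lin2 d (a b c : R) : lt 0 d -> le w1 d -> le w2 d -> deg_le (lin2 a b c) d.
Proof.
move=> d0 w1d w2d; apply: wdeg_leD; last by apply: wdeg_leC; rewrite // ltGW.
apply: wdeg_leD; apply: wdeg_leZ; case: (wdeg_isX R Hle w1 w2 i0) => H0 _;
  case: (wdeg_isX R Hle w1 w2 i1) => H1 _.
- by apply: (wdeg_le_trans Hle H0); rewrite wt0.
- by apply: (wdeg_le_trans Hle H1); rewrite wt1.
Qed.

Lemma deg_is_coefU f (i : 'I_2) : deg_le f (wt i) -> f@_U_(i) != 0 -> deg_is f (wt i).
Proof. by move=> fi nz; split=> //; exists U_(i)%MM; rewrite // mcoeff_msupp. Qed.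

(** If the second component contains the heavier variable, that variable fixes its degree. If not,
    the invertible determinant forces the first component to contain it and the second to contain
    the lighter one. *)
Lemma Gbar_state g : Gbar G g -> growing g \/ initial g.
Proof.
move=> /(Gbar_affE HGaff)[a [b [c [a' [b' [c' [-> det]]]]]]].
have [i [j [ij wji wi0 wij]]] := exists_heavy.
have lewi k : le (wt k) (wt i).
  have [->|nki] := eqVneq k i; first exact: (leG_refl Hle).
  suff -> : k = j by [].
  move: ij nki; case: (ord2P i) => ->; case: (ord2P j) => ->;
    by case: (ord2P k) => ->.
have le1 := lewi i0; have le2 := lewi i1; rewrite wt0 in le1; rewrite wt1 in le2.
have Hlin (x y z : R) : deg_le (lin2 x y z) (wt i) by apply: deg_le_lin2.
have [u0|u0] := eqVneq (lin2 a' b' c')@_U_(i) 0; last first.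
  by left; exists (wt i); split=> //; [apply: deg_is_coefU; first exact: Hlin | exact: Hlin].
right; exists i, j, (lin2 a' b' c')@_U_(j), c'; split=> //.
have nz (x y : R) : x * y \is a GRing.unit -> x != 0 /\ y != 0.
  by move=> u; split; apply: contraTneq u => ->; rewrite ?mul0r ?mulr0 unitr0.
move: ij u0 (Hlin a b c); case: (ord2P i) => ->; case: (ord2P j) => -> //= _.
  rewrite !lin2_coef0 !lin2_coef1 => a0 degf.
  move: det; rewrite a0 mulr0 subr0 => /nz[na nb'].
  by split=> //; rewrite /affE /lin2 /= scale0r add0r.
rewrite !lin2_coef0 !lin2_coef1 => b0 degf.
move: det; rewrite b0 mulr0 sub0r unitrN => /nz[nb na'].
by split=> //; rewrite /affE /lin2 /= scale0r addr0.
Qed.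

(** With $n = \deg p \ge 2$, the term $p(b)$ has degree $nd > d$, out of reach of the old first
    component, while the second stays in degree at most $d$. *)
Lemma dominated_of_growing chi tau : growing chi -> big_triangular tau ->
  dominated (endo_comp chi tau).
Proof.
move=> [d [bd d0 fd]] [a [p [u [e [ua uu sp ->]]]]].
rewrite [chi]endo2_eta comp_triangular; set b := tnth chi i1; set f := tnth chi i0.
have p0 : p != 0 by rewrite -size_poly_gt0 (leq_trans _ sp).
have n1 : (1 < (size p).-1)%N by case: (size p) sp.
have dn := ltG_mulrn Hle d0 n1.
exists (d *+ (size p).-1); split; rewrite ?tnth_endo2.
- rewrite addrC; apply: wdeg_is_addlt; first exact: wdeg_is_phorner.
  exact: (wdeg_le_lt Hle (wdeg_leZ fd) dn).
- by apply: mulrn_gtG0; rewrite // (leq_trans _ n1).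
- apply: wdeg_ltD; first by apply: wdeg_ltZ; apply: (wdeg_le_lt Hle bd.1 dn).
  by apply: wdeg_ltC; apply: (ltG_le_trans Hle d0); apply: ltGW.
Qed.

Lemma deg_is_linearX (j : 'I_2) (v c : R) : v != 0 -> lt 0 (wt j) ->
  deg_is (v *: 'X_j + c%:MP) (wt j).
Proof.
move=> v0 wj; apply: wdeg_is_addlt; last exact: wdeg_ltC.
exact: (wdeg_isZ v0 (wdeg_isX R Hle w1 w2 j)).
Qed.

Lemma deg_le0_linearX (j : 'I_2) (v c : R) : le (wt j) 0 ->
  deg_le (v *: 'X_j + c%:MP) 0.
Proof.
move=> wj; apply: wdeg_leD; last by apply: wdeg_leC; exact: (leG_refl Hle).
by apply: wdeg_leZ; apply: (wdeg_le_trans Hle (wdeg_isX R Hle w1 w2 j).1).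
Qed.

Lemma unit_neq0 (a : R) : a \is a GRing.unit -> a != 0.
Proof. by apply: contraTneq => ->; rewrite unitr0. Qed.

(** Let $n = \deg p$. If $w_j \le 0$, or if $0 < n w_j \le w_i$, the monomial $x_i$ survives and the
    first component has degree $w_i$; if $n w_j > w_i$, the term $p(b)$ takes over. The second
    component lies strictly lower each time. *)
Lemma dominated_of_initial chi tau : initial chi -> big_triangular tau ->
  dominated (endo_comp chi tau).
Proof.
move=> [i [j [v [c [[ij wji wi0 _] [fi nz Eb v0]]]]]] [a [p [u [e [ua uu sp ->]]]]].
rewrite [chi]endo2_eta comp_triangular Eb; set f := tnth chi i0 in fi nz *.
have p0 : p != 0 by rewrite -size_poly_gt0 (leq_trans _ sp).
have n1 : (1 < (size p).-1)%N by case: (size p) sp.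
have lead : deg_le (phorner p (v *: 'X_j + c%:MP)) (wt i) ->
    deg_is (a *: f + phorner p (v *: 'X_j + c%:MP)) (wt i).
  move=> pi; apply: deg_is_coefU; first by apply: wdeg_leD => //; apply: wdeg_leZ.
  (* a polynomial in x_j cannot cancel the monomial x_i *)
  by rewrite mcoeffD mcoeff_phornerU // addr0 mcoeffZ mulf_neq0 // unit_neq0.
have second d : lt 0 d -> lt (wt j) d ->
    deg_lt (u *: (v *: 'X_j + c%:MP) + e%:MP) d.
  move=> d0 jd; apply: wdeg_ltD; last exact: wdeg_ltC.
  apply: wdeg_ltZ; apply: wdeg_ltD; last exact: wdeg_ltC.
  by apply: wdeg_ltZ; apply: (wdeg_le_lt Hle (wdeg_isX R Hle w1 w2 j).1).
case: (leGVltG Hle (wt j) 0) => wj0.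
  exists (wt i); split; rewrite ?tnth_endo2 //.
    2: by apply: second => //; apply: (leG_lt_trans Hle wj0).
  apply: lead; apply: (@wdeg_le_trans _ _ _ Hle _ _ _ 0); last exact: ltGW.
  by apply: wdeg_le_phorner => //; apply: deg_le0_linearX.
have bj := deg_is_linearX c v0 wj0.
have pbj := wdeg_is_phorner Hle p0 wj0 bj.
have jn := ltG_mulrn Hle wj0 n1.
have n0 : lt 0 (wt j *+ (size p).-1) by apply: (ltG_le_trans Hle wj0); apply: ltGW.
case: (leGVltG Hle (wt j *+ (size p).-1) (wt i)) => nji.
  exists (wt i); split; rewrite ?tnth_endo2 //.
    by apply: lead; apply: (wdeg_le_trans Hle pbj.1).
  by apply: second => //; apply: (ltG_le_trans Hle jn).
exists (wt j *+ (size p).-1); split; rewrite ?tnth_endo2 //; last exact: second.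
rewrite addrC; apply: wdeg_is_addlt => //.
exact: (wdeg_le_lt Hle (wdeg_leZ fi) nji).
Qed.

Lemma deg_is_comb (a b c : R) f h d : a != 0 -> lt 0 d -> deg_is f d -> deg_lt h d ->
  deg_is (a *: f + b *: h + c%:MP) d.
Proof.
move=> a0 d0 fd hd; apply: wdeg_is_addlt; last exact: wdeg_ltC.
by apply: wdeg_is_addlt; [exact: wdeg_isZ | exact: wdeg_ltZ].
Qed.

(** A lower [g] copies the strictly larger first component into the second, where nothing can cancel
    its leading form. *)
Lemma growing_of_dominated chi g : dominated chi -> Gbar G g -> is_lower g ->
  growing (endo_comp chi g).
Proof.
move=> [d [fd d0 bd]] /(Gbar_affE HGaff)[a [b [c [a' [b' [c' [-> _]]]]]]].
rewrite /is_lower /= lin2_coef0 => na; exists d.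
rewrite [chi]endo2_eta endo_comp_endo2 !comp_lin2; split; rewrite ?tnth_endo2 //.
  exact: deg_is_comb.
apply: wdeg_leD; last by apply: wdeg_leC; exact: ltGW.
apply: wdeg_leD; apply: wdeg_leZ; last exact: wdeg_ltW.
exact: fd.1.
Qed.

Lemma ok_form_state chi : ok_form G chi -> growing chi \/ initial chi.
Proof.
elim=> {chi} [g|chi tau g _ IH bt Gg lw]; first exact: Gbar_state.
left; apply: growing_of_dominated => //.
by case: IH => [/dominated_of_growing|/dominated_of_initial]; apply.
Qed.

Lemma ok_form_dominated chi tau : ok_form G chi -> big_triangular tau ->
  dominated (endo_comp chi tau).
Proof.
move=> /ok_form_state[/dominated_of_growing|/dominated_of_initial]; exact.
Qed.

(** * Reductions at the end of a word *)

Local Notation wdegE := (wdeg_endo le w1 w2).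

Lemma wdeg_endo2 f h : wdegE (endo2 f h) = wdeg le w1 w2 f + wdeg le w1 w2 h.
Proof. by []. Qed.

(** From a growing state, undoing [p] lowers the first degree from $nd$ to at most $d$. From an
    initial state, one elementary step brings the degree down to exactly $w_1+w_2$, and strictness
    is the hypothesis. *)
Lemma ok_form_elem_reduction chi tau : ok_form G chi -> big_triangular tau ->
  lt (w1 + w2) (wdegE (endo_comp chi tau)) ->
  admits_elem_reduction le w1 w2 (endo_comp chi tau).
Proof.
move=> okc bt.
have [a [p [u [e [ua uu sp Et]]]]] := bt.
(* The second component of the composite is $ub+e$, with $b$ that of [chi]; precomposing [p] with
   $u^{-1}(X-e)$ recovers $p(b)$ from it. *)
pose eps := elementary0 1 (- (p \Po (u^-1 *: ('X - e%:P)))).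
have Aeps : in_Aut_over_A i0 eps by apply: elementary0_in_Aut; exact: unitr1.
have kill : endo_comp (endo_comp chi tau) eps =
    endo2 (a *: tnth chi i0) (u *: tnth chi i1 + e%:MP).
  rewrite Et [chi]endo2_eta comp_triangular comp_elementary0 /=; congr endo2.
  rewrite scale1r phornerN phorner_comp phornerZ phornerD phornerN phornerX phornerC.
  by rewrite addrK scalerA mulVr // scale1r addrK.
have p0 : p != 0 by rewrite -size_poly_gt0 (leq_trans _ sp).
have n1 : (1 < (size p).-1)%N by case: (size p) sp.
have nu := unit_neq0 uu; have na := unit_neq0 ua.
case: (ok_form_state okc) => [[d [bd d0 fd]] _|].
  exists i0, eps; split=> //.
  rewrite kill Et [chi]endo2_eta comp_triangular !wdeg_endo2 /=.
  apply: (ltG_le_add Hle); last exact: (leG_refl Hle).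
  have dn := ltG_mulrn Hle d0 n1.
  have fE : deg_is (phorner p (tnth chi i1) + a *: tnth chi i0) (d *+ (size p).-1).
    apply: wdeg_is_addlt; first exact: wdeg_is_phorner.
    exact: (wdeg_le_lt Hle (wdeg_leZ fd) dn).
  rewrite [a *: _ + _]addrC (wdeg_isE Hle fE).
  apply: (leG_lt_trans Hle) dn; apply: (wdeg_leE Hle); first exact: ltGW.
  exact: wdeg_leZ.
move=> [i [j [v [c [[ij wji wi0 wij] [fi nz Eb v0]]]]]] Hdeg.
have lin : u *: (v *: 'X_j + c%:MP) + e%:MP = (u * v) *: 'X_j + (u * c + e)%:MP.
  by rewrite scalerDr scalerA -addrA -(mul_mpolyC u c%:MP) -mpolyCM -mpolyCD.
case: (leGVltG Hle (wt j) 0) => wj0; last first.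
  exists i0, eps; split=> //.
  rewrite kill wdeg_endo2 Eb lin.
  rewrite (wdeg_isE Hle (d := wt i)) ?(wdeg_isE Hle (d := wt j)) ?wij //.
    by apply: deg_is_linearX; rewrite ?mulf_neq0.
  by apply: wdeg_isZ => //; apply: deg_is_coefU.
(* When $w_j \le 0$, the term $p(b)$ leaves the first degree at $w_i$. Any excess comes from the
   constant $uc+e$ of the second component, which has degree 0 and is subtracted here. *)
exists i1, (elementary1 1 (- (u * c + e)%:P)); split.
  by apply: elementary1_in_Aut; exact: unitr1.
move: Hdeg; rewrite Et [chi]endo2_eta comp_triangular comp_elementary1 Eb lin.
rewrite phornerN phornerC scale1r addrK => Hdeg.
rewrite wdeg_endo2 (wdeg_isE Hle (d := wt i)) ?(wdeg_isE Hle (d := wt j)) ?wij //.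
  by apply: (wdeg_isZ _ (wdeg_isX R Hle w1 w2 j)); rewrite mulf_neq0.
apply: deg_is_coefU.
  apply: wdeg_leD; first exact: wdeg_leZ.
  apply: (@wdeg_le_trans _ _ _ Hle _ _ _ 0); last exact: ltGW.
  by apply: wdeg_le_phorner => //; apply: deg_le0_linearX.
by rewrite mcoeffD mcoeff_phornerU // addr0 mcoeffZ mulf_neq0.
Qed.

Lemma wdeg_endo_swapE phi : wdegE (endo_comp phi (@swapE R)) = wdegE phi.
Proof. by rewrite [phi]endo2_eta comp_swapE !wdeg_endo2 addrC. Qed.

(** Exchanging the components keeps the total degree, and conjugation by the exchange turns each
    kind of elementary automorphism into the other. *)
Lemma elem_reduction_swapE phi : admits_elem_reduction le w1 w2 (endo_comp phi (@swapE R)) ->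
  admits_elem_reduction le w1 w2 phi.
Proof.
move=> [i [eps [Aeps lt_eps]]]; rewrite wdeg_endo_swapE in lt_eps.
suff [k Ak] : exists k, in_Aut_over_A k (endo_comp (@swapE R) (endo_comp eps (@swapE R))).
  by exists k; eexists; split; first exact: Ak; rewrite !endo_compA wdeg_endo_swapE.
move: Aeps; case: (ord2P i) => -> => [/in_Aut_elementary0|/in_Aut_elementary1] [a [p [ua ->]]].
  by exists i1; rewrite -elementary1_conj; apply: elementary1_in_Aut.
exists i0; rewrite elementary1_conj -!endo_compA swapEK endo_comp1 endo_compA swapEK endo_1comp.
exact: elementary0_in_Aut.
Qed.

Lemma wdeg_endo_id : wdegE (idE R) = w1 + w2.
Proof.
rewrite idE_endo2 wdeg_endo2 (wdeg_isE Hle (wdeg_isX R Hle w1 w2 i0)).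
by rewrite (wdeg_isE Hle (wdeg_isX R Hle w1 w2 i1)) wt0 wt1.
Qed.

Lemma normal_form_reduction phi : normal_form G phi -> lt (w1 + w2) (wdegE phi) ->
  admits_Gbar_reduction G le w1 w2 phi \/ admits_elem_reduction le w1 w2 phi.
Proof.
case=> [|[chi [tau [okc bt ->]]] Hdeg]; last by right; apply: ok_form_elem_reduction.
case=> {phi} [g Gg|chi tau g okc bt Gg _] Hdeg.
  (* A word without triangular factors is undone by its inverse in [Gbar G], leaving the identity,
     of degree $w_1+w_2$. *)
  have [h [inv _] Gh] := Gbar_inverse HGaff Gg.
  by left; exists h; rewrite inv wdeg_endo_id.
(* If the first component of [g] lacks $x_1$, then after an exchange the second one does, so [g]
   followed by the exchange is triangular and joins [tau]. *)
have [a0|a0] := eqVneq (tnth g i0)@_U_(i0) 0.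
  right; apply: elem_reduction_swapE.
  have Ggs : Gbar G (endo_comp g (@swapE R)) by apply: gen_comp => //; apply: Gbar_swapE.
  case: (Gbar_case HGaff Ggs); first by rewrite /is_lower tnth_endo_comp comp_mpolyXE a0 eqxx.
  move=> st; rewrite -!endo_compA.
  apply: (ok_form_elem_reduction okc (big_triangular_comp_small bt st)).
  by rewrite !endo_compA wdeg_endo_swapE.
have [lw|st] := Gbar_case HGaff Gg; last first.
  right; rewrite -endo_compA.
  apply: (ok_form_elem_reduction okc (big_triangular_comp_small bt st)).
  by rewrite endo_compA.
(* Both components of [g] contain $x_1$, so both components of the composite have degree $d$.
   Removing [g] restores the degrees $d$ and something below $d$. *)
left; have [h [inv _] Gh] := Gbar_inverse HGaff Gg.
exists h; split=> //; rewrite -endo_compA inv endo_comp1.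
have [d [fd d0 bd]] := ok_form_dominated okc bt.
move: a0 lw {Hdeg inv}; have [a [b [c [a' [b' [c' [-> _]]]]]]] := Gbar_affE HGaff Gg.
rewrite /is_lower /= !lin2_coef0 => na na'.
move: fd bd; rewrite [endo_comp chi tau]endo2_eta endo_comp_endo2 !comp_lin2 !wdeg_endo2 /=.
move=> fd bd; rewrite (wdeg_isE Hle fd) !(wdeg_isE Hle (deg_is_comb _ _ _ d0 fd bd)) //.
by apply: (leG_lt_add Hle); [exact: (leG_refl Hle) | exact: wdeg_ltE].
Qed.

End Growth.

Theorem theorem1p2p1 (R : idomainType) (G : endo R -> Prop)
  (HG : is_subgroup G) (HGaff : forall phi, G phi -> Aff phi)
  (Γ : zmodType) (le : rel Γ) (HΓ : is_tot_ord_group le)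
  (w1 w2 : Γ) (Hw : ltG le 0 w1 \/ ltG le 0 w2)
  (phi : endo R) (Hphi : Gplus G phi)
  (Hdeg : ltG le (w1 + w2) (wdeg_endo le w1 w2 phi)) :
  admits_Gbar_reduction G le w1 w2 phi \/ admits_elem_reduction le w1 w2 phi.
Proof.
case: HΓ => Hle _; apply: normal_form_reduction => //.
exact: Gplus_normal_form.
Qed.
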